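(* Let $m\ge2$, $n\ge2$ be integers and for $\kappa\in\{3,4\}$ let $t_\kappa(m,n)$ be the number of threshold functions $g$ on $E_m\times E_n$ with $|T(g)|=\kappa$. Then $$t_3(m,n)=2 f_2(m,n)+8,\qquad t_4(m,n)=f_1(m,n)-2f_2(m,n)-6.$$
   Context: Let $E_k=\{0,1,\dots,k-1\}$. A function $g:E_m\times E_n\to\{0,1\}$ is a threshold function if there exist real $a_0,a_1,a_2$ with $\{x\in E_m\times E_n: g(x)=0\}=\{(x_1,x_2)\in E_m\times E_n: a_1x_1+a_2x_2\le a_0\}$. Let $\mathcal{T}(m,n)$ be the set of threshold functions on $E_m\times E_n$. A set $T\subseteq E_m\times E_n$ is teaching for $g\in\mathcal{T}(m,n)$ if for every $h\in\mathcal{T}(m,n)$ with $h\ne g$ there is $x\in T$ with $g(x)\ne h(x)$; it is minimal if no proper subset is teaching. It is known that the minimal teaching set of each $g$ is unique, denoted $T(g)$, and that $|T(g)|\in\{3,4\}$. For a positive integer $q$, $$f_q(m,n)=\sum_{\substack{-m<i<m,\ -n<j<n\\ \gcd(i,j)=q}}(m-|i|)(n-|j|),$$ the sum over integers $i,j$. *)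

(* Defs.v *)
From mathcomp Require Import all_boot all_order all_algebra zify.
From mathcomp Require Import boolp reals.

Set Implicit Arguments.
Unset Strict Implicit.
Unset Printing Implicit Defensive.

Import Order.TTheory GRing.Theory Num.Theory.
Local Open Scope ring_scope.

Section Threshold.
Variables (R : realType) (m n : nat).

(* E_m x E_n is 'I_m * 'I_n; the values 0 and 1 are false and true *)
Notation point := ('I_m * 'I_n)%type.
Notation bfun := {ffun point -> bool}.

Definition is_threshold (g : bfun) : Prop :=
  exists a0 a1 a2 : R, forall x : point,
    g x = false <-> a1 * (x.1 : nat)%:R + a2 * (x.2 : nat)%:R <= a0.

Definition thresholds : {set bfun} := [set g | `[< is_threshold g >]].

Definition teaching (g : bfun) (T : {set point}) : bool :=
  [forall h in thresholds, (h != g) ==> [exists x in T, g x != h x]].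

Lemma teaching_setT g : teaching g [set: point].
Proof.
apply/forall_inP => h _; apply/implyP => neq_hg; apply: contraNT neq_hg.
rewrite negb_exists => /forallP eq_gh; apply/eqP/ffunP => x.
by have := eq_gh x; rewrite in_setT /= negbK => /eqP.
Qed.

Lemma minimal_teaching_exists g : exists T, minset (teaching g) T.
Proof.
by have [T minT _] := minset_exists (teaching_setT g); exists T.
Qed.

(* The minimal teaching set of a threshold function is unique, so the choice
   made here does not matter. *)
Definition minimal_teaching_set (g : bfun) : {set point} :=
  xchoose (minimal_teaching_exists g).

Definition t_teach (k : nat) : nat :=
  #|[set g in thresholds | #|minimal_teaching_set g| == k]|.

End Threshold.

Definition open_range (m : nat) : seq int :=
  [seq k%:Z - m%:Z | k <- iota 1 (2 * m - 1)].

Lemma mem_open_range m i : ((i : int) \in open_range m) = (- m%:Z < i < m%:Z).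
Proof.
apply/mapP/idP => [[k]|lt_im]; first by rewrite mem_iota => ? ->; lia.
by exists (absz (i + m%:Z)); rewrite ?mem_iota; lia.
Qed.

Lemma open_range_uniq m : uniq (open_range m).
Proof. by rewrite map_inj_uniq ?iota_uniq // => a b; lia. Qed.

Definition f_gcd (q m n : nat) : int :=
  \sum_(i <- open_range m) \sum_(j <- open_range n | gcdz i j == q%:Z)
    (m%:Z - `|i|) * (n%:Z - `|j|).

(* Main.v *)
Require Import Defs.
From mathcomp Require Import all_boot all_order all_algebra.
From mathcomp Require Import boolp reals.
From mathcomp Require Import zify ring lra.

(* Call x essential for g if flipping g at x leaves a threshold function. Moving
   a representation of g linearly to one of h crosses the points of disagreement
   one at a time (generically), so the essential points form a teaching set, and
   they lie in every teaching set: T(g) is the set of essential points.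

   For a point x and a primitive vector d let c(x, d) be the function that is 1
   strictly to the left of the line x + Rd and on its part strictly beyond x.
   Turning separating lines clockwise as far as possible shows that
   - the nonconstant threshold functions are the c(A, B - A), with B - A
     primitive, each obtained once: there are f_1 + 2 threshold functions;
   - the pairs (g, x) with x essential and g(x) = 0 are the (c(x, d), x) with d
     primitive and x + d or x - d in the grid, each obtained once: there are
     2 f_1 - f_2 of them, hence the |T(g)| add up to 4 f_1 - 2 f_2.

   It remains to see that |T(g)| is 3 or 4. It is at least 3 since a threshold
   function can take any prescribed values at three noncollinear points. For the
   upper bound let g be nonconstant, x essential and g(x) = 0. Either x + d is in
   the grid, which happens for one x, or g is 1 exactly to the left of the line
   x + Rd. If two such lines with directions d and e described g, then comparing
   them at the corners of the rectangles spanned by x - d, x and by y - e, y puts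
   d and e in one open quadrant, and a point of the grid in a direction between d
   and e (d or e itself, or the coordinatewise minimum of the two) lies on the
   wrong side of one of the lines. So g has at most two essential zeros, and by
   symmetry at most two essential ones. *)

Set Implicit Arguments.
Unset Strict Implicit.
Unset Printing Implicit Defensive.

Import Order.TTheory GRing.Theory Num.Theory.
Local Open Scope ring_scope.

(** * Strict representations; the teaching set as the set of essential points *)

Section StrictRepresentation.
Variables (R : realType) (m n : nat).
Notation point := ('I_m * 'I_n)%type.
Notation bfun := {ffun point -> bool}.
Implicit Types (f : R * R * R) (g h : bfun) (x y : point).

Definition affine f x : R :=
  f.1.1 * (x.1 : nat)%:R + f.1.2 * (x.2 : nat)%:R + f.2.

Definition signed (b : bool) (r : R) : R := if b then r else - r.

Definition represents f g := forall x, 0 < signed (g x) (affine f x).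

Definition combine (s : R) f1 f2 : R * R * R :=
  (s * f1.1.1 + f2.1.1, s * f1.1.2 + f2.1.2, s * f1.2 + f2.2).

Lemma affine_combine s f1 f2 x :
  affine (combine s f1 f2) x = s * affine f1 x + affine f2 x.
Proof. by rewrite /affine /=; ring. Qed.

Lemma signedN b r : signed (~~ b) r = - signed b r.
Proof. by case: b => /=; rewrite ?opprK. Qed.

Lemma signedD b r s : signed b (r + s) = signed b r + signed b s.
Proof. by case: b => //=; rewrite opprD. Qed.

Lemma signedM b r s : signed b (r * s) = r * signed b s.
Proof. by case: b => //=; rewrite mulrN. Qed.

Lemma signed0 b : signed b 0 = 0.
Proof. by case: b => //=; rewrite oppr0. Qed.

Lemma normr_signed b r : `|signed b r| = `|r|.
Proof. by case: b => //=; rewrite normrN. Qed.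

Lemma represents_threshold f g : represents f g -> is_threshold R g.
Proof.
move=> fg; exists (- f.2), f.1.1, f.1.2 => x; have := fg x.
by rewrite /affine; case: (g x) => /= fgx; split=> // *; lra.
Qed.

(* The zeros of [g] may lie on the threshold line: it is moved by half the
   smallest positive value taken on the ones. *)
Lemma threshold_represents g : is_threshold R g -> exists f, represents f g.
Proof.
move=> [a0 [a1 [a2 ga]]].
pose v x : R := a1 * (x.1 : nat)%:R + a2 * (x.2 : nat)%:R - a0.
pose e : R := \big[Order.min/1]_(x | g x) v x.
have e_gt0 : 0 < e.
  apply: (big_ind (fun r : R => 0 < r)) => // [r s r0 s0|x gx].
    by rewrite lt_min r0.
  rewrite /v subr_gt0 ltNge; apply/negP => le_a.
  by have /(ga x) := le_a; rewrite gx.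
exists (a1, a2, - a0 - e / 2) => x; rewrite /affine /=.
case gx: (g x) => /=.
  by have := bigmin_le_cond 1 v gx; rewrite -/e /v; lra.
by have := (ga x).1 gx; lra.
Qed.

(** A large enough multiple of [f1] outweighs [f2] wherever [f1] does not vanish, so [f2] decides
    only on the line of [f1]: an infinitesimal motion made finite. *)
Lemma lexicographic_represents f1 f2 g :
    (forall x, 0 < signed (g x) (affine f1 x) \/
       affine f1 x = 0 /\ 0 < signed (g x) (affine f2 x)) ->
  exists2 s, 0 < s & represents (combine s f1 f2) g.
Proof.
move=> g12; pose r x := `|affine f2 x| / `|affine f1 x|.
have r_ge0 x : 0 <= r x by rewrite divr_ge0.
exists (1 + \sum_x r x); first by rewrite ltr_pwDl ?sumr_ge0.
move=> x; rewrite affine_combine signedD signedM.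
case: (g12 x) => [g1|[-> g2]]; last by rewrite signed0 mulr0 add0r.
have nz1 : 0 < `|affine f1 x| by rewrite -(normr_signed (g x)) normr_gt0 gt_eqF.
have lt_s : r x < 1 + \sum_x r x.
  by rewrite ltr_pwDl // (bigD1 x) //= lerDl sumr_ge0.
have e1 : signed (g x) (affine f1 x) = `|affine f1 x|.
  by rewrite -(normr_signed (g x)) gtr0_norm.
have : `|affine f2 x| < (1 + \sum_x r x) * `|affine f1 x|.
  by rewrite -ltr_pdivrMr.
rewrite e1 -(normr_signed (g x) (affine f2 x)).
by have := ler_norm (- signed (g x) (affine f2 x)); rewrite normrN; lra.
Qed.

Lemma lexicographic_threshold f1 f2 g :
    (forall x, 0 < signed (g x) (affine f1 x) \/
       affine f1 x = 0 /\ 0 < signed (g x) (affine f2 x)) ->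
  is_threshold R g.
Proof. by move/lexicographic_represents=> [s _ /represents_threshold]. Qed.

Definition negf g : bfun := [ffun x => ~~ g x].

Lemma negfK : involutive negf.
Proof. by move=> g; apply/ffunP=> x; rewrite !ffunE negbK. Qed.

Lemma negf_threshold g : is_threshold R g -> is_threshold R (negf g).
Proof.
move/threshold_represents=> [f fg]; apply: (@represents_threshold (combine (-1) f 0)).
move=> x; rewrite affine_combine ffunE signedN signedD signedM.
by have := fg x; rewrite /affine /= !mul0r !addr0 signed0; lra.
Qed.

Definition flip g x : bfun := [ffun y => g y (+) (y == x)].

Lemma flip_neq g x : flip g x != g.
Proof. by apply/eqP=> /ffunP/(_ x); rewrite ffunE eqxx addbT; case: (g x). Qed.

Lemma negf_flip g x : negf (flip g x) = flip (negf g) x.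
Proof. by apply/ffunP=> y; rewrite !ffunE addNb. Qed.

Definition essential g : {set point} := [set x | `[< is_threshold R (flip g x) >]].

Lemma essential_negf g : essential (negf g) = essential g.
Proof.
apply/setP=> x; rewrite !inE -negf_flip; apply/asboolP/asboolP=> /negf_threshold //.
by rewrite negfK.
Qed.

Lemma affine_eq0_separated x y : x != y -> exists2 f, affine f x = 0 & affine f y != 0.
Proof.
rewrite -pair_eqE /= negb_and => /orP[] neq_xy.
  exists (1, 0, - (x.1 : nat)%:R); rewrite /affine /=; first by ring.
  by rewrite mul1r mul0r addr0 subr_eq0 eqr_nat eq_sym.
exists (0, 1, - (x.2 : nat)%:R); rewrite /affine /=; first by ring.
by rewrite mul1r mul0r add0r subr_eq0 eqr_nat eq_sym.
Qed.

(* Moving from a representation of [g] to one of [h] flips the points of the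
   disagreement set one after the other; if two of them are flipped at
   different times, an intermediate function lies strictly between. *)
Lemma intermediate_threshold f1 f2 g h x y :
    represents f1 g -> represents f2 h -> g x != h x -> g y != h y ->
    affine f2 x / affine f1 x != affine f2 y / affine f1 y ->
  exists h' : bfun, [/\ is_threshold R h', h' != g &
    [set z | g z != h' z] \proper [set z | g z != h z]].
Proof.
move=> fg fh gx gy neq_xy; pose s z := - (affine f2 z / affine f1 z).
have nz1 z : affine f1 z != 0.
  by have := fg z; apply: contraTneq => ->; rewrite signed0 ltxx.
wlog: x y gx gy neq_xy / s y < s x.
  move=> Hw; have : s x != s y by rewrite eqr_opp.
  rewrite neq_lt => /orP[lt_s|lt_s]; last exact: (Hw x y).
  by apply: (Hw y x) => //; rewrite eq_sym.
(* As the weight of [f1] in [combine s f1 f2] falls from infinity to 0, the function passes from [g]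
   to [h], and a disagreement [z] is crossed at weight [s z]; [z0] is crossed first. *)
move=> lt_s; have [z0 gz0 max_s] :=
  @arg_maxP _ _ _ x (fun z => g z != h z) s gx.
have value z : s z0 * affine f1 z + affine f2 z = (s z0 - s z) * affine f1 z.
  have -> : affine f2 z = - s z * affine f1 z by rewrite opprK divfK.
  by rewrite mulrDl.
have s_gt0 z : g z != h z -> 0 < s z.
  move=> neq_z; have := fg z; have := fh z; rewrite /s.
  have -> : affine f2 z = affine f2 z / affine f1 z * affine f1 z by rewrite divfK.
  have -> : h z = ~~ g z by move: neq_z; case: (g z); case: (h z).
  rewrite mulfK // signedM signedN => ? fgz.
  suff : affine f2 z / affine f1 z < 0 by lra.
  by rewrite -(pmulr_llt0 _ fgz); lra.
(* At the weight [s z0] the points flipped here lie on the line, and [f2] puts them on the side of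
   [h]; [y] is crossed later and is not flipped yet. *)
pose h' : bfun := [ffun z => if (g z != h z) && (s z == s z0) then h z else g z].
exists h'; split.
- apply: (@lexicographic_threshold (combine (s z0) f1 f2) f2) => z.
  rewrite affine_combine value ffunE.
  have [neq_z|/negbNE/eqP eq_z] := boolP (g z != h z); last first.
    rewrite /= -value signedD signedM; left.
    by rewrite addr_gt0 ?mulr_gt0 ?s_gt0 ?fg ?eq_z ?fh.
  rewrite /=; have [->|neq_s] := eqVneq (s z) (s z0).
    by right; rewrite subrr mul0r; split=> //; apply: fh.
  left; rewrite signedM mulr_gt0 ?fg // subr_gt0 lt_neqAle neq_s.
  exact: max_s.
- apply/eqP=> /ffunP/(_ z0); rewrite ffunE gz0 eqxx /= => e.
  by move: gz0; rewrite e eqxx.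
apply/properP; split.
  by apply/subsetP=> z; rewrite !inE ffunE; case: (g z != h z) => //=; rewrite eqxx.
have lt_y : s y < s z0 by apply: lt_le_trans lt_s (max_s _ gx).
by exists y; rewrite !inE // ffunE gy (lt_eqF lt_y) /= eqxx.
Qed.

(** Induction on the number of disagreements: a single one is essential for [g], and otherwise an
    intermediate function disagrees with [g] on a proper subset. *)
Lemma essential_separates g h : is_threshold R g -> is_threshold R h -> h != g ->
  exists2 x, x \in essential g & g x != h x.
Proof.
move=> thg; have [k] := ubnP #|[set z | g z != h z]|.
elim: k h => // k IHk h; rewrite ltnS => le_k thh neq_hg.
have [x gx] : exists x, g x != h x.
  apply/existsP; apply: contraNT neq_hg => /existsPn eq_gh.
  by apply/eqP/ffunP=> x; have := eq_gh x; rewrite negbK => /eqP.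
have [/forallP one|] := boolP [forall y, (g y != h y) ==> (y == x)].
  exists x => //; rewrite inE; apply/asboolP; suff -> : flip g x = h by [].
  apply/ffunP=> y; rewrite ffunE; have := one y.
  have [->|neq_xy] := eqVneq y x; first by move: gx; case: (g x); case: (h x).
  by rewrite implybF negbK addbF => /eqP.
rewrite negb_forall => /existsP[y]; rewrite negb_imply => /andP[gy].
rewrite eq_sym => neq_xy.
suff [h' [thh' neq_h' sub_h']] : exists h' : bfun, [/\ is_threshold R h', h' != g &
    [set z | g z != h' z] \proper [set z | g z != h z]].
  have [|z zess gz] := IHk _ _ thh' neq_h'.
    exact: leq_trans (proper_card sub_h') le_k.
  exists z => //; have /subsetP/(_ z) := proper_sub sub_h'.
  by rewrite !inE => ->.
have [f1 fg] := threshold_represents thg.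
have [f2 fh] := threshold_represents thh.
have nz (f : R * R * R) (g' : bfun) z : represents f g' -> affine f z != 0.
  by move/(_ z); apply: contraTneq => ->; rewrite signed0 ltxx.
have [eq_xy|] := eqVneq (affine f2 x / affine f1 x) (affine f2 y / affine f1 y);
  last exact: intermediate_threshold fg fh gx gy.
(* Here [x] and [y] are crossed together. Replacing [f1] by [s * f1 + c], with [c] zero at [x] but
   not at [y], still represents [g] and separates the two crossings. *)
have [c cx cy] := affine_eq0_separated neq_xy.
have [|s s_gt0 fg'] := @lexicographic_represents f1 c g; first by left.
apply: (intermediate_threshold fg' fh gx gy).
rewrite !affine_combine cx addr0; apply: contraNneq cy => e.
have nzy : s * affine f1 y + affine c y != 0 by rewrite -affine_combine (nz _ _ _ fg').
have nzx : s * affine f1 x != 0 by rewrite mulf_neq0 ?(nz _ _ _ fg) ?gt_eqF.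
have /eqP := e; rewrite eqr_div // => /eqP e2.
have /eqP := eq_xy; rewrite eqr_div ?(nz _ _ _ fg) // => /eqP e1.
suff /eqP : affine f2 x * affine c y = 0 by rewrite mulf_eq0 (negPf (nz _ _ _ fh)).
by have := congr1 ( *%R s) e1; rewrite mulrDr in e2; lra.
Qed.

Lemma minimal_teaching_set_essential g :
  is_threshold R g -> minimal_teaching_set R g = essential g.
Proof.
move=> thg; have := xchooseP (minimal_teaching_exists R g).
rewrite -/(minimal_teaching_set R g); move: (minimal_teaching_set R g) => T.
case/minsetP=> /forall_inP teachT minT; apply/esym/minT.
  apply/forall_inP=> h; rewrite inE => /asboolP thh; apply/implyP=> neq_hg.
  have [x xess gx] := essential_separates thg thh neq_hg.
  by apply/existsP; exists x; rewrite xess.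
(* [flip g x] differs from [g] at [x] only, so [T] cannot tell them apart without [x]. *)
apply/subsetP=> x; rewrite inE => /asboolP thx.
have := teachT (flip g x); rewrite inE asboolT // => /(_ isT).
rewrite flip_neq => /existsP[y /andP[yT]]; rewrite ffunE.
by have [<-//|_] := eqVneq y x; rewrite addbF eqxx.
Qed.

End StrictRepresentation.

(** * Primitive integer vectors in the plane *)

Section PlaneVectors.
Implicit Types d e u v : int * int.

Definition cross d e : int := d.1 * e.2 - d.2 * e.1.
Definition dot d e : int := d.1 * e.1 + d.2 * e.2.
Definition scale (k : int) d : int * int := (k * d.1, k * d.2).
Definition primitive d : bool := gcdz d.1 d.2 == 1.

Lemma dot_self_gt0 v : v != (0, 0) -> 0 < dot v v.
Proof.
by case: v => a b; rewrite -pair_eqE /dot /= negb_and => /orP[]; nia.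
Qed.

Lemma primitive_neq0 d : primitive d -> d != (0, 0).
Proof. by apply: contraTneq => ->. Qed.

Lemma primitive_dot_gt0 d : primitive d -> 0 < dot d d.
Proof. by move/primitive_neq0/dot_self_gt0. Qed.

Lemma collinear_primitive d v : primitive d -> cross d v = 0 ->
  exists t, v = scale t d.
Proof.
case: d v => a b [p q]; rewrite /primitive /cross /scale /= => /eqP gab crs.
have [r [s rs]] := Bezoutz a b; rewrite gab in rs.
(* As [r * a + s * b = 1], the linear form with coefficients [r], [s] reads off the multiplier of
   [d]. *)
exists (r * p + s * q); congr pair.
  have -> : (r * p + s * q) * a = (r * a + s * b) * p + s * (a * q - b * p) by ring.
  by rewrite rs crs mul1r mulr0 addr0.
have -> : (r * p + s * q) * b = (r * a + s * b) * q - r * (a * q - b * p) by ring.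
by rewrite rs crs mul1r mulr0 subr0.
Qed.

Lemma primitive_scale_eq1 d t : primitive d -> primitive (scale t d) -> 0 < t -> t = 1.
Proof.
case: d => a b; rewrite /primitive /scale /= => /eqP gab.
rewrite /gcdz !abszM -muln_gcdr.
by move: gab; rewrite /gcdz => -[->]; rewrite muln1 => /eqP; lia.
Qed.

Lemma primitive_direction d e :
  primitive d -> primitive e -> cross d e = 0 -> 0 < dot d e -> d = e.
Proof.
move=> pd pe /(collinear_primitive pd)[t te] de; rewrite te in pe de *.
have t_gt0 : 0 < t.
  have := primitive_dot_gt0 pd; move: de; rewrite /dot /scale /=; nia.
by rewrite (primitive_scale_eq1 pd pe t_gt0) /scale !mul1r; case: (d).
Qed.

Lemma primitive_part v : v != (0, 0) ->
  exists d (k : int), [/\ primitive d, 0 < k & v = scale k d].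
Proof.
case: v => a b nz; pose k := gcdz a b.
have k_neq0 : k != 0.
  by rewrite gcdz_eq0; apply: contra nz => /andP[/eqP-> /eqP->].
have k_gt0 : 0 < k by rewrite lt_neqAle eq_sym k_neq0.
have ea : a = k * (a %/ k)%Z by rewrite mulrC divzK ?dvdz_gcdl.
have eb : b = k * (b %/ k)%Z by rewrite mulrC divzK ?dvdz_gcdr.
exists ((a %/ k)%Z, (b %/ k)%Z), k; split=> //; last by rewrite /scale /= -ea -eb.
have : k = `|k| * gcdz (a %/ k)%Z (b %/ k)%Z by rewrite mulz_gcdr -ea -eb.
rewrite gtr0_norm // /primitive /= => e; apply/eqP/(mulfI k_neq0).
by rewrite -e mulr1.
Qed.

End PlaneVectors.

(** * The most clockwise vector in an open half-plane *)

Section ClockwiseExtreme.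
Variable R : realType.

Definition linform (a b : R) (v : int * int) : R := a * v.1%:~R + b * v.2%:~R.

(** [slope i] is the tangent of the angle from [(a, b)] to [v i]. All vectors lie in one open
    half-plane, so the least slope belongs to the most clockwise one. *)
Lemma clockwise_extreme (I : finType) (P : pred I) (v : I -> int * int) (a b : R) i0 :
    P i0 -> (forall i, P i -> 0 < linform a b (v i)) ->
  exists2 i, P i & forall j, P j -> 0 <= cross (v i) (v j).
Proof.
move=> Pi0 v_gt0; pose slope i : R := linform (- b) a (v i) / linform a b (v i).
have [i Pi min_i] := @arg_minP _ _ _ i0 P slope Pi0.
exists i => // j Pj; have := min_i j Pj; rewrite /slope.
rewrite ler_pdivrMr ?v_gt0 // mulrAC ler_pdivlMr ?v_gt0 // -subr_ge0.
have ab_gt0 : 0 < a ^+ 2 + b ^+ 2.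
  rewrite lt_neqAle eq_sym addr_ge0 ?sqr_ge0 // andbT paddr_eq0 ?sqr_ge0 //.
  apply: contraTN (v_gt0 i Pi); rewrite !sqrf_eq0 => /andP[/eqP-> /eqP->].
  by rewrite /linform !mul0r addr0 ltxx.
have -> : linform (- b) a (v j) * linform a b (v i) -
    linform (- b) a (v i) * linform a b (v j) =
    (a ^+ 2 + b ^+ 2) * (cross (v i) (v j))%:~R.
  by rewrite /linform /cross intrB !intrM; ring.
by rewrite pmulr_rge0 // ler0z.
Qed.

Lemma parallel_dot_gt0 (a b : R) u v :
  0 < linform a b u -> 0 < linform a b v -> cross u v = 0 -> 0 < dot u v.
Proof.
move=> u_gt0 v_gt0 uv0.
have e : linform a b u * (dot u v)%:~R = linform a b v * (dot u u)%:~R.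
  have c0 : u.1%:~R * v.2%:~R - u.2%:~R * v.1%:~R = 0 :> R.
    by rewrite -!intrM -intrB -/(cross u v) uv0.
  rewrite /linform /dot !intrD !intrM; apply/eqP; rewrite -subr_eq0.
  set lhs := (X in X == 0).
  have -> : lhs = (u.1%:~R * v.2%:~R - u.2%:~R * v.1%:~R) *
     (a * u.2%:~R - b * u.1%:~R) by rewrite /lhs; ring.
  by rewrite c0 mul0r.
have uu : 0 < dot u u.
  apply: dot_self_gt0; apply: contraTneq u_gt0 => ->.
  by rewrite /linform /= !mulr0 addr0 ltxx.
by rewrite -(ltr0z R) -(pmulr_rgt0 _ u_gt0) e pmulr_rgt0 // ltr0z.
Qed.

End ClockwiseExtreme.

(** * The functions c(x, d) and the threshold functions they describe *)

Section Colourings.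
Variables (R : realType) (m n : nat).
Notation point := ('I_m * 'I_n)%type.
Notation bfun := {ffun point -> bool}.
Implicit Types (g h : bfun) (p q x y z : point) (d e : int * int).

Definition vec p q : int * int :=
  ((q.1 : nat)%:Z - (p.1 : nat)%:Z, (q.2 : nat)%:Z - (p.2 : nat)%:Z).

Lemma point_at (a b : int) : 0 <= a < m%:Z -> 0 <= b < n%:Z ->
  exists q, (q.1 : nat)%:Z = a /\ (q.2 : nat)%:Z = b.
Proof.
move=> a_in b_in.
have am : (`|a| < m)%N by lia.
have bn : (`|b| < n)%N by lia.
by exists (Ordinal am, Ordinal bn) => /=; lia.
Qed.

Lemma eq_point p q : (p.1 : nat)%:Z = (q.1 : nat)%:Z ->
  (p.2 : nat)%:Z = (q.2 : nat)%:Z -> p = q.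
Proof.
case: p q => [p1 p2] [q1 q2] /= e1 e2.
by congr pair; apply/val_inj => /=; lia.
Qed.

Lemma vec_inj p : injective (vec p).
Proof. by move=> q q' [e1 e2]; apply: eq_point; lia. Qed.

Lemma vec_injl q : injective (vec^~ q).
Proof. by move=> p p' [e1 e2]; apply: eq_point; lia. Qed.

Lemma vec_eq0 p q : (vec p q == (0, 0)) = (p == q).
Proof.
apply/eqP/eqP=> [[e1 e2]|->]; first by apply: eq_point; lia.
by rewrite /vec !subrr.
Qed.

Lemma point_between p q k d t :
  vec p q = scale k d -> 0 <= t <= k -> exists q', vec p q' = scale t d.
Proof.
case: d => a b [e1 e2] t_in.
have := (ltn_ord p.1, ltn_ord p.2, ltn_ord q.1, ltn_ord q.2).
move=> [[[lp1 lp2] lq1] lq2].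
have [||r [r1 r2]] := @point_at ((p.1 : nat)%:Z + t * a) ((p.2 : nat)%:Z + t * b).
- by case: (lerP 0 a) => ?; nia.
- by case: (lerP 0 b) => ?; nia.
by exists r; rewrite /vec /scale /=; congr pair; lia.
Qed.

(** The function c(x, d): the sign of the pair of [cross] and [dot] in lexicographic order, with [x]
    itself counted as a zero. *)
Definition colouring x d : bfun :=
  [ffun p => (0 < cross d (vec x p)) ||
             (cross d (vec x p) == 0) && (0 < dot d (vec x p))].

Lemma colouring_base x d : colouring x d x = false.
Proof. by rewrite ffunE /vec !subrr /cross /dot /= !mulr0 addr0 !ltxx. Qed.

Lemma colouringP x d p : if colouring x d p
  then 0 < cross d (vec x p) \/ cross d (vec x p) = 0 /\ 0 < dot d (vec x p)
  else cross d (vec x p) < 0 \/ cross d (vec x p) = 0 /\ dot d (vec x p) <= 0.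
Proof. by rewrite ffunE; case: ltgtP => //= ?; case: ltP => /= ?; lia. Qed.

Lemma colouring_tip x y : primitive (vec x y) -> colouring x (vec x y) y.
Proof.
move=> pd; rewrite ffunE (_ : cross _ _ = 0) ?ltxx ?eqxx ?primitive_dot_gt0 //.
by rewrite /cross; ring.
Qed.

Definition affz (f : int * int * int) x : int :=
  f.1.1 * (x.1 : nat)%:Z + f.1.2 * (x.2 : nat)%:Z + f.2.

Lemma affine_intr (f : int * int * int) x :
  affine (f.1.1%:~R : R, f.1.2%:~R, f.2%:~R) x = (affz f x)%:~R.
Proof. by rewrite /affine /affz /= !intrD !intrM. Qed.

Lemma signed_intr b (k : int) :
  (0 < signed b (k%:~R : R)) = if b then 0 < k else k < 0.
Proof. by case: b => /=; rewrite ?oppr_gt0 ?ltr0z ?ltrz0. Qed.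

Lemma integer_lexicographic_threshold (f1 f2 : int * int * int) g :
    (forall x, (if g x then 0 < affz f1 x else affz f1 x < 0) \/
       affz f1 x = 0 /\ (if g x then 0 < affz f2 x else affz f2 x < 0)) ->
  is_threshold R g.
Proof.
move=> g12; apply: (@lexicographic_threshold R m n
  (f1.1.1%:~R, f1.1.2%:~R, f1.2%:~R) (f2.1.1%:~R, f2.1.2%:~R, f2.2%:~R)) => x.
rewrite !affine_intr !signed_intr; case: (g12 x) => [|[->]]; first by left.
by right.
Qed.

Definition crossf x d : int * int * int :=
  (- d.2, d.1, d.2 * (x.1 : nat)%:Z - d.1 * (x.2 : nat)%:Z).

(** Doubling makes room for half a step along [d]: for [c] equal to 1 or -1 the form never vanishes
    on the grid, and [c] decides its sign only where [dot] is 0. *)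
Definition dotf x d (c : int) : int * int * int :=
  (2 * d.1, 2 * d.2, c - 2 * d.1 * (x.1 : nat)%:Z - 2 * d.2 * (x.2 : nat)%:Z).

Lemma affz_crossf x d p : affz (crossf x d) p = cross d (vec x p).
Proof. by rewrite /affz /cross /=; ring. Qed.

Lemma affz_dotf x d c p : affz (dotf x d c) p = 2 * dot d (vec x p) + c.
Proof. by rewrite /affz /dot /=; ring. Qed.

Lemma colouring_threshold x d : is_threshold R (colouring x d).
Proof.
apply: (@integer_lexicographic_threshold (crossf x d) (dotf x d (-1))) => p.
rewrite affz_crossf affz_dotf.
by have := colouringP x d p; case: (colouring x d p) => -[|[]]; lia.
Qed.

Lemma cross_dot_eq0 d p q : d != (0, 0) ->
  cross d (vec p q) = 0 -> dot d (vec p q) = 0 -> p = q.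
Proof.
move=> /dot_self_gt0 dd cr dt; apply/eqP; rewrite -vec_eq0.
move: (vec p q) cr dt => v cr dt.
have e1 : dot d d * v.1 = d.1 * dot d v - d.2 * cross d v.
  by rewrite /dot /cross; ring.
have e2 : dot d d * v.2 = d.2 * dot d v + d.1 * cross d v.
  by rewrite /dot /cross; ring.
move: e1 e2; rewrite cr dt !mulr0 ?(subr0, addr0) => /eqP e1 /eqP e2.
move: e1 e2; rewrite !mulf_eq0 (gt_eqF dd) /=.
by case: v {cr dt} => v1 v2 /= /eqP-> /eqP->.
Qed.

(** Only [x] has both [cross] and [dot] zero, so changing the shift of the second form from -1 to 1
    flips [x] alone. *)
Lemma colouring_essential x d : d != (0, 0) -> x \in essential R (colouring x d).
Proof.
move=> nz; rewrite inE; apply/asboolP.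
apply: (@integer_lexicographic_threshold (crossf x d) (dotf x d 1)) => p.
rewrite affz_crossf affz_dotf ffunE; have [->|neq_px] := eqVneq p x.
  by rewrite colouring_base /vec !subrr /cross /dot /= !mulr0; right.
have := @cross_dot_eq0 d x p nz; move/eqP: neq_px => neq_px.
have := colouringP x d p; rewrite addbF; case: (colouring x d p) => -[|[cr dt] eq_xp].
- by left.
- by right; lia.
- by left.
right; split=> //; suff : dot d (vec x p) != 0 by lia.
by apply/eqP=> dt0; apply/neq_px/esym/eq_xp.
Qed.

Lemma affineB (f : R * R * R) p q :
  affine f q - affine f p = linform f.1.1 f.1.2 (vec p q).
Proof. by rewrite /affine /linform /= !intrB; ring. Qed.

Lemma cross_vecC d p q : cross d (vec p q) = - cross d (vec q p).
Proof. by rewrite /cross /=; ring. Qed.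

Lemma dot_vecC d p q : dot d (vec p q) = - dot d (vec q p).
Proof. by rewrite /dot /=; ring. Qed.

Lemma cross_scale k d v : cross (scale k d) v = k * cross d v.
Proof. by rewrite /cross /=; ring. Qed.

Lemma dot_scale k d v : dot (scale k d) v = k * dot d v.
Proof. by rewrite /dot /=; ring. Qed.

(* A separating line through [x] alone is turned clockwise about [x] until it
   meets another point. *)
Lemma essential_colouring g x z0 : z0 != x ->
    is_threshold R g -> x \in essential R g -> ~~ g x ->
  exists d, [/\ primitive d, g = colouring x d &
    (exists q, vec x q = d) \/ (exists q, vec q x = d)].
Proof.
move=> neq_z0 /threshold_represents[f1 fg]; rewrite inE => /asboolP.
move=> /threshold_represents[f2 fx] /negbTE gx.
have F1x : affine f1 x < 0 by have := fg x; rewrite gx /=; lra.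
have F2x : 0 < affine f2 x by have := fx x; rewrite ffunE gx eqxx.
(* The weight at which the combined form vanishes at [x]; since [g] and its flip agree elsewhere,
   all other points keep strict signs. *)
pose s := affine f2 x / - affine f1 x.
have s_gt0 : 0 < s by rewrite divr_gt0 // oppr_gt0.
pose H := combine s f1 f2.
have Hx : affine H x = 0.
  by rewrite affine_combine /s invrN mulrN mulNr divfK ?addNr // lt_eqF.
have Hz z : z != x -> 0 < signed (g z) (affine H z).
  move=> neq_z; rewrite affine_combine signedD signedM.
  by have := fx z; rewrite ffunE (negbTE neq_z) addbF; have := fg z; nra.
pose v z := if g z then vec x z else vec z x.
have v_gt0 z : z != x -> 0 < linform H.1.1 H.1.2 (v z).
  by move/Hz; rewrite /v /signed; case: (g z); rewrite -affineB Hx ?subr0 ?sub0r.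
have [z z_neq min_z] := @clockwise_extreme R _ (fun z => z != x) v _ _ z0 neq_z0 v_gt0.
have nz : v z != (0, 0).
  by rewrite /v; case: (g z); rewrite vec_eq0 // eq_sym.
have [d [k [pd k_gt0 vz]]] := primitive_part nz.
exists d; split=> //.
  apply/ffunP=> p; have [->|neq_p] := eqVneq p x; first by rewrite colouring_base.
  have c_ge0 := min_z p neq_p; rewrite vz cross_scale pmulr_rge0 // in c_ge0.
  have d_gt0 : cross d (v p) = 0 -> 0 < dot d (v p).
    move=> c0; have := parallel_dot_gt0 (v_gt0 z z_neq) (v_gt0 p neq_p).
    by rewrite vz cross_scale c0 mulr0 dot_scale pmulr_rgt0 //; apply.
  move: c_ge0 d_gt0; rewrite /v; have := colouringP x d p.
  case: (g p); case: (colouring x d p) => //.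
    by case=> [|[]]; lia.
  by rewrite cross_vecC dot_vecC; case=> [|[]]; lia.
move: vz; rewrite /v; case: (g z) => vz; [left|right].
  have [|q vq] := point_between (t := 1) vz; first by lia.
  by exists q; rewrite vq /scale !mul1r; case: (d).
(* Here [v z] points from the zero [z] to [x], so [x - d] is reached from [z] after [k - 1]
   steps. *)
have [|q vq] := point_between (t := k - 1) vz; first by lia.
exists q; move: vq vz; case: (d) => a b [e1 e2] [e3 e4].
by rewrite /vec; congr pair; lia.
Qed.

(** Along the line the form is affine in [t], negative at 0 and positive at 1, hence increasing; and
    [t] is an integer. *)
Lemma represents_on_line g (f : R * R * R) p q r d t :
  represents f g -> vec p q = d -> ~~ g p -> g q -> vec p r = scale t d ->
  g r = (0 < t).
Proof.
move=> fg vq gp gq vr.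
have F_d : affine f q - affine f p = linform f.1.1 f.1.2 d by rewrite affineB vq.
have F_r : affine f r - affine f p = t%:~R * linform f.1.1 f.1.2 d.
  by rewrite affineB vr /linform /= !intrM; ring.
move: (linform _ _ _) F_d F_r => L F_d F_r.
have := fg p; have := fg q; rewrite (negbTE gp) gq /= => fq fp.
have := fg r; case: (ltP 0 t) => t0; case: (g r) => //= fr; exfalso; clear vq vr.
  have t1 : 1 <= t%:~R :> R by rewrite ler1z; lia.
  nra.
have t1 : t%:~R <= 0 :> R by rewrite lerz0.
nra.
Qed.

(** The most clockwise vector from a zero to a one gives the line; [A] and [B] are the consecutive
    grid points on it where [g] changes from 0 to 1. *)
Lemma nonconstant_colouring g p0 q0 : is_threshold R g -> ~~ g p0 -> g q0 ->
  exists A B, primitive (vec A B) /\ g = colouring A (vec A B).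
Proof.
move=> /threshold_represents[f fg] gp0 gq0.
pose P (z : point * point) := ~~ g z.1 && g z.2.
pose v (z : point * point) := vec z.1 z.2.
have v_gt0 (z : point * point) : P z -> 0 < linform f.1.1 f.1.2 (v z).
  move=> /andP[/negbTE g1 g2]; rewrite -affineB.
  by have := fg z.1; have := fg z.2; rewrite g1 g2 /=; lra.
have P0 : P (p0, q0) by rewrite /P gp0 gq0.
have [[p q] /andP[/= gp gq] min_pq] := clockwise_extreme P0 v_gt0.
have nz : vec p q != (0, 0) by rewrite vec_eq0; apply: contraNneq gp => ->.
have [d [k [pd k_gt0 vpq]]] := primitive_part nz.
pose ok t := [exists r, (vec p r == scale t%:Z d) && g r].
have exk : exists t, ok t.
  exists `|k|%N; apply/existsP; exists q; rewrite gq andbT vpq.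
  by apply/eqP; congr scale; lia.
have [t /existsP[B /andP[/eqP vB gB]] min_t] := ex_minnP exk.
have t_gt0 : (0 < t)%N.
  rewrite lt0n; apply: contraNneq gp => t0; suff <- : B = p by [].
  by apply/esym/eqP; rewrite -vec_eq0 vB t0 /scale !mul0r.
have [|A vA] := point_between (t := t%:Z - 1) vB; first by lia.
have gA : ~~ g A.
  apply/negP=> gA; have := min_t t.-1; suff -> : ok t.-1 by move/(_ isT); lia.
  apply/existsP; exists A; rewrite gA andbT vA; apply/eqP; congr scale; lia.
have vAB : vec A B = d.
  move: vA vB; case: (d) => a b [e1 e2] [e3 e4].
  by rewrite /vec; congr pair; lia.
exists A, B; rewrite vAB; split=> //.
have crossA r : cross d (vec A r) = cross d (vec p r).
  move: vA; case: (d) => a b [e1 e2]; rewrite /cross /=; nia.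
have crossq r : cross d (vec q r) = cross d (vec p r).
  move: vpq; case: (d) => a b [e1 e2]; rewrite /cross /=; nia.
(* The extreme pair is compared with [(p, r)] if [r] is a one and with [(r, q)] if it is a zero. *)
have side r : if g r then 0 <= cross d (vec A r) else cross d (vec A r) <= 0.
  rewrite crossA; case gr: (g r).
    have := min_pq (p, r); rewrite /P /v /= gp gr vpq cross_scale pmulr_rge0 //.
    by apply.
  have := min_pq (r, q); rewrite /P /v /= gq gr vpq cross_scale pmulr_rge0 //.
  by rewrite cross_vecC crossq oppr_ge0; apply.
apply/ffunP=> r; have := colouringP A d r; have := side r.
have [c0|] := eqVneq (cross d (vec A r)) 0; last first.
  by case: (g r); case: (colouring A d r) => //; lia.
have [u vr] := collinear_primitive pd c0.
have -> : g r = (0 < u) by apply: (represents_on_line fg vAB).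
have := primitive_dot_gt0 pd.
have -> : dot d (vec A r) = u * dot d d by rewrite vr /dot /=; ring.
rewrite c0 ltxx; case: (colouring A d r) => dd _ [//|[_]].
  by rewrite pmulr_lgt0 // => ->.
by rewrite pmulr_lle0 // => /le_gtF->.
Qed.

(** Evaluation at [x + d] or [x - d] shows that [d] is not clockwise of [e]. By symmetry the two are
    parallel, and they are not opposite. *)
Lemma colouring_direction_inj x d e : primitive d -> primitive e ->
    (exists q, vec x q = d) \/ (exists q, vec q x = d) ->
    (exists q, vec x q = e) \/ (exists q, vec q x = e) ->
  colouring x d = colouring x e -> d = e.
Proof.
have aux d' e' : primitive d' -> primitive e' ->
    (exists q, vec x q = d') \/ (exists q, vec q x = d') ->
    colouring x d' = colouring x e' ->
  0 < cross e' d' \/ cross e' d' = 0 /\ 0 <= dot e' d'.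
  move=> pd pe [][q vq] /ffunP/(_ q); have := colouringP x e' q.
    have -> : colouring x d' q.
      rewrite ffunE vq (_ : cross d' d' = 0) ?ltxx ?eqxx ?primitive_dot_gt0 //.
      by rewrite /cross; ring.
    by move=> + eqc; rewrite -eqc vq; lia.
  have -> : colouring x d' q = false.
    have := primitive_dot_gt0 pd.
    rewrite ffunE cross_vecC dot_vecC vq (_ : cross d' d' = 0); last first.
      by rewrite /cross; ring.
    by rewrite oppr0 ltxx eqxx /=; lia.
  by move=> + eqc; rewrite -eqc cross_vecC dot_vecC vq; lia.
move=> pd pe xd xe eqc; have := aux d e pd pe xd eqc.
have := aux e d pe pd xe (esym eqc).
have -> : cross d e = - cross e d by rewrite /cross; ring.
have -> : dot d e = dot e d by rewrite /dot; ring.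
move=> h1 h2; have c0 : cross e d = 0 by lia.
apply/esym/primitive_direction => //.
have [t dt] := collinear_primitive pe c0.
have : dot e d != 0.
  have := primitive_dot_gt0 pe; have := primitive_dot_gt0 pd; rewrite dt /dot /scale /=; nia.
lia.
Qed.

(** [A] is a zero and [B] a one of the second function, so [B - A] is not clockwise of [B' - A']. By
    symmetry the directions agree and the four points lie on one line. *)
Lemma colouring_pair_inj A B A' B' :
    primitive (vec A B) -> primitive (vec A' B') ->
    colouring A (vec A B) = colouring A' (vec A' B') -> A = A' /\ B = B'.
Proof.
have aux C D C' D' : primitive (vec C D) -> primitive (vec C' D') ->
    colouring C (vec C D) = colouring C' (vec C' D') ->
    let d := vec C' D' in
    [/\ 0 <= cross d (vec C' D), cross d (vec C' C) <= 0 &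
      cross d (vec C' D) = 0 -> cross d (vec C' C) = 0 ->
      0 < dot d (vec C' D) /\ dot d (vec C' C) <= 0].
  move=> p1 p2 eqc d; have := colouring_tip p1; have := colouring_base C (vec C D).
  rewrite eqc -/d => b1 b2; have := colouringP C' d C; have := colouringP C' d D.
  by rewrite b1 b2 => i1 i2; split=> [||c1 c2]; lia.
move=> p1 p2 eqc.
have [h1 h2 h3] := aux _ _ _ _ p1 p2 eqc.
have [h4 h5 _] := aux _ _ _ _ p2 p1 (esym eqc).
have e1 : cross (vec A' B') (vec A B) =
   cross (vec A' B') (vec A' B) - cross (vec A' B') (vec A' A).
  by rewrite /cross /=; ring.
have e2 : cross (vec A' B') (vec A B) = 
   - (cross (vec A B) (vec A B') - cross (vec A B) (vec A A')).
  by rewrite /cross /=; ring.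
have [c1 c2] : cross (vec A' B') (vec A' B) = 0 /\ cross (vec A' B') (vec A' A) = 0.
  by lia.
have [d1 d2] := h3 c1 c2.
have e3 : dot (vec A' B') (vec A B) =
   dot (vec A' B') (vec A' B) - dot (vec A' B') (vec A' A).
  by rewrite /dot /=; ring.
have eqv : vec A' B' = vec A B by apply: primitive_direction => //; lia.
have [t vt] := collinear_primitive p2 c2.
have e4 : dot (vec A' B') (vec A' A) = t * dot (vec A' B') (vec A' B').
  by rewrite vt /dot /scale /=; ring.
(* With the common direction d, [A] is A' + t d and [B] is A' + (t + 1) d; the second lies beyond
   [A'] and the first does not. *)
have t0 : t = 0.
  have D_gt0 := primitive_dot_gt0 p2; rewrite -eqv e4 in e3; rewrite e4 in d2.
  move: (dot _ (vec A' B')) (dot _ (vec A' B)) D_gt0 d1 d2 e3; nia.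
have eA : A = A'.
  by apply/eqP; rewrite eq_sym -vec_eq0 vt t0 /scale !mul0r.
by split=> //; rewrite eA in eqv; apply/esym/(vec_inj eqv).
Qed.

End Colourings.

(** * Lines that cut off the same grid points *)

Section ParallelEdges.
Variables (m n : nat).
Notation point := ('I_m * 'I_n)%type.
Implicit Types (p q x y z : point) (d e : int * int).

Definition same_side x d y e := forall p, (0 < cross d (vec x p)) = (0 < cross e (vec y p)).

Lemma same_sideC x d y e : same_side x d y e -> same_side y e x d.
Proof. by move=> xy p; rewrite xy. Qed.

Lemma cross_self_vec d p : cross d (vec p p) = 0.
Proof. by rewrite /vec !subrr /cross !mulr0 subrr. Qed.

(** If [e] is not parallel to an axis, one further corner of the rectangle with diagonal from [y']
    to [y] is strictly left of the second line, while [y] and [y'] are not. The same then holds for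
    the first line, and the differences of [cross d] along the two sides get their signs. *)
Lemma same_side_corner x d y y' e : same_side x d y e -> vec y' y = e ->
  (0 < e.1 * e.2 -> 0 < d.1 * e.2 /\ 0 < d.2 * e.1) /\
  (e.1 * e.2 < 0 -> d.1 * e.2 < 0 /\ d.2 * e.1 < 0).
Proof.
case: d e => a b [a' b'] side [e1 e2] /=.
have := side y; have := side y'; have := side (y'.1, y.2); have := side (y.1, y'.2).
rewrite /cross /=.
move: (x.1 : nat)%:Z (x.2 : nat)%:Z => x1 x2.
have -> : (y.1 : nat)%:Z = (y'.1 : nat)%:Z + a' by lia.
have -> : (y.2 : nat)%:Z = (y'.2 : nat)%:Z + b' by lia.
move: (y'.1 : nat)%:Z (y'.2 : nat)%:Z => y1 y2 h1 h2 h3 h4.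
by split=> ab; split; lia.
Qed.

(** The points [y' + d] and [y - d] fit into the rectangle spanned by [y'] and [y]. A shift by [d]
    preserves [cross d], so neither is left of the first line; but unless [d] and [e] are parallel,
    one is left of the second. *)
Lemma same_side_smaller x d y y' e : same_side x d y e -> vec y' y = e ->
  0 < d.1 * e.1 -> 0 < d.2 * e.2 -> `|d.1| <= `|e.1| -> `|d.2| <= `|e.2| ->
  cross d e = 0.
Proof.
case: d e => a b [a' b'] side [e1 e2] /= aa bb le_a le_b.
have lim := (ltn_ord y.1, ltn_ord y.2, ltn_ord y'.1, ltn_ord y'.2).
have [||p [p1 p2]] := @point_at m n ((y'.1 : nat)%:Z + a) ((y'.2 : nat)%:Z + b).
- by move: lim => [[[]]]; have [?|?] := ltP 0 a; nia.
- by move: lim => [[[]]]; have [?|?] := ltP 0 b; nia.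
have [||q [q1 q2]] := @point_at m n ((y.1 : nat)%:Z - a) ((y.2 : nat)%:Z - b).
- by move: lim => [[[]]]; have [?|?] := ltP 0 a; nia.
- by move: lim => [[[]]]; have [?|?] := ltP 0 b; nia.
have := side y; have := side y'; have := side p; have := side q.
rewrite /cross /= p1 p2 q1 q2.
move: (x.1 : nat)%:Z (x.2 : nat)%:Z => x1 x2.
have -> : (y.1 : nat)%:Z = (y'.1 : nat)%:Z + a' by lia.
have -> : (y.2 : nat)%:Z = (y'.2 : nat)%:Z + b' by lia.
move: (y'.1 : nat)%:Z (y'.2 : nat)%:Z => y1 y2; clear; lia.
Qed.

(* The vector [(d.1, e.2)] lies strictly between [d] and [e]. *)
Lemma same_side_incomparable x d y y' e : same_side x d y e -> vec y' y = e ->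
  0 < d.1 * e.1 -> 0 < d.2 * e.2 -> `|d.1| < `|e.1| -> `|e.2| < `|d.2| -> False.
Proof.
case: d e => a b [a' b'] side [e1 e2] /= aa bb lt_a lt_b.
have lim := (ltn_ord y.1, ltn_ord y.2, ltn_ord y'.1, ltn_ord y'.2).
have [||p [p1 p2]] := @point_at m n ((y'.1 : nat)%:Z + a) (y.2 : nat)%:Z.
- by move: lim => [[[]]]; have [?|?] := ltP 0 a; nia.
- by move: lim => [[[]]]; lia.
have [||q [q1 q2]] := @point_at m n ((y.1 : nat)%:Z - a) (y'.2 : nat)%:Z.
- by move: lim => [[[]]]; have [?|?] := ltP 0 a; nia.
- by move: lim => [[[]]]; lia.
have := side y; have := side y'; have := side p; have := side q.
rewrite /cross /= p1 p2 q1 q2.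
move: (x.1 : nat)%:Z (x.2 : nat)%:Z => x1 x2.
have -> : (y.1 : nat)%:Z = (y'.1 : nat)%:Z + a' by lia.
have -> : (y.2 : nat)%:Z = (y'.2 : nat)%:Z + b' by lia.
move: (y'.1 : nat)%:Z (y'.2 : nat)%:Z => y1 y2 {side e1 e2 lim p q p1 p2 q1 q2} h1 h2 h3 h4.
(* If the coordinates of [e] have equal signs, [p] is left of the second line but not of the first;
   otherwise [q] is. *)
have [b'_gt0|b'_le0] := ltP 0 b'; have [a'_gt0|a'_le0] := ltP 0 a'.
- have i1 : 0 < b' * (a' - a) by nia.
  have i2 : 0 < a * (b - b') by nia.
  lia.
- have i1 : b' * (a' - a) < 0 by nia.
  have i2 : a * (b - b') < 0 by nia.
  lia.
- have i1 : b' * (a' - a) < 0 by nia.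
  have i2 : a * (b - b') < 0 by nia.
  lia.
have i1 : 0 < b' * (a' - a) by nia.
have i2 : 0 < a * (b - b') by nia.
lia.
Qed.

(** If the lines were perpendicular, [z] could be moved parallel to the second line onto the first:
    it would stay strictly left of the second only. *)
Lemma same_side_axis x d y e z : same_side x d y e -> 0 < cross e (vec y z) ->
  d.1 * d.2 = 0 -> e.1 * e.2 = 0 -> cross d e = 0.
Proof.
case: d e => a b [a' b'] side; rewrite /cross /= => ez.
move=> /eqP; rewrite mulf_eq0 => dd /eqP; rewrite mulf_eq0 => ee.
have := side (x.1, z.2); have := side (z.1, x.2); rewrite /cross /= !subrr.
by move: dd ee ez => /orP[]/eqP-> /orP[]/eqP->; rewrite ?mul0r ?mulr0; lia.
Qed.

Lemma same_side_direction x x' d y y' e z :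
    same_side x d y e -> vec x' x = d -> vec y' y = e ->
    primitive d -> primitive e -> 0 < cross e (vec y z) -> d = e.
Proof.
move=> side vx vy pd pe ez.
have c0 : cross d e = 0.
  have [posE negE] := same_side_corner side vy.
  have [posD negD] := same_side_corner (same_sideC side) vx.
  have crossC : cross e d = - cross d e by rewrite /cross; ring.
  have [e0|e_neq0] := eqVneq (e.1 * e.2) 0.
    apply: (same_side_axis side ez _ e0); apply/eqP; apply: contraTT isT => dd.
    have /orP[/eqP ee|/eqP ee] : (e.1 == 0) || (e.2 == 0) by rewrite -mulf_eq0 e0.
      by move: dd posD negD; rewrite ee neq_lt ?mul0r ?mulr0 => /orP[]dd pos neg; lia.
    by move: dd posD negD; rewrite ee neq_lt ?mul0r ?mulr0 => /orP[]dd pos neg; lia.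
  have [aa bb] : 0 < d.1 * e.1 /\ 0 < d.2 * e.2.
    by move: e_neq0; rewrite neq_lt => /orP[]ee;
      [have := negE ee|have := posE ee]; move: ee; clear; nia.
  have aa' : 0 < e.1 * d.1 by rewrite mulrC.
  have bb' : 0 < e.2 * d.2 by rewrite mulrC.
  have smallD := same_side_smaller side vy aa bb.
  have smallE := same_side_smaller (same_sideC side) vx aa' bb'.
  have incD := same_side_incomparable side vy aa bb.
  have incE := same_side_incomparable (same_sideC side) vx aa' bb'.
  have [le_a|lt_a] := lerP `|d.1| `|e.1|; have [le_b|lt_b] := lerP `|d.2| `|e.2|.
  - exact: smallD.
  - move: le_a; rewrite le_eqVlt => /orP[/eqP eq_a|lt_a]; last by case: incD.
    by rewrite -[LHS]opprK -crossC smallE ?oppr0 // ?eq_a // ltW.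
  - move: le_b; rewrite le_eqVlt => /orP[/eqP eq_b|lt_b]; last by case: incE.
    by rewrite -[LHS]opprK -crossC smallE ?oppr0 // ?eq_b // ltW.
  by rewrite -[LHS]opprK -crossC smallE ?oppr0 // ltW.
apply: primitive_direction => //; have [t et] := collinear_primitive pd c0.
(* The point [z] is strictly left of both lines and [y] of neither, which excludes opposite
   directions. *)
have := side z; have := side y; rewrite cross_self_vec ltxx ez => sy sz.
have dz : cross d (vec x z) = cross d (vec x y) + cross d (vec y z).
  by rewrite /cross /=; ring.
have -> : dot d e = t * dot d d by rewrite et /dot /=; ring.
rewrite pmulr_lgt0 ?primitive_dot_gt0 //; move: ez; rewrite et cross_scale.
move: (cross d (vec y z)) dz sz sy => w dz sz sy; nia.
Qed.

End ParallelEdges.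

Lemma neq_ord k (i : 'I_k) : (2 <= k)%N -> exists j : 'I_k, j != i.
Proof.
move=> k2; have k0 : (0 < k)%N by lia.
have [i0|i0] := eqVneq (i : nat) 0%N.
  by exists (Ordinal k2); rewrite -val_eqE /= i0.
by exists (Ordinal k0); rewrite -val_eqE /= eq_sym.
Qed.

(** * Every threshold function has three or four essential points *)

Section EssentialBounds.
Variables (R : realType) (m n : nat).
Hypotheses (m_ge2 : (2 <= m)%N) (n_ge2 : (2 <= n)%N).
Notation point := ('I_m * 'I_n)%type.
Notation bfun := {ffun point -> bool}.
Implicit Types (g h : bfun) (p q r x y z : point) (d e : int * int).

Lemma other_point x : exists z, z != x.
Proof.
have [j neq_j] := neq_ord x.1 m_ge2.
by exists (j, x.2); apply: contraNneq neq_j => <-.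
Qed.

(** By convexity of the grid, a grid point beyond [x] on the line would put [x + d] into the
    grid. *)
Lemma last_on_line x d : primitive d -> ~ (exists q, vec x q = d) ->
  forall p, colouring x d p = (0 < cross d (vec x p)).
Proof.
move=> pd xd p; rewrite ffunE; have [//|//|c0] /= := ltgtP 0 (cross d (vec x p)).
have [t vt] := collinear_primitive pd (esym c0); apply/negP=> dt.
have t_gt0 : 0 < t.
  move: dt; have -> : dot d (vec x p) = t * dot d d by rewrite vt /dot /=; ring.
  by rewrite pmulr_lgt0 ?primitive_dot_gt0.
have [|q vq] := point_between (t := 1) vt; first by lia.
by apply: xd; exists q; rewrite vq /scale !mul1r; case: (d).
Qed.

Definition essential0 g : {set point} := [set x in essential R g | ~~ g x].

Lemma essential0_negf g : essential0 (negf g) = [set x in essential R g | g x].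
Proof. by apply/setP=> x; rewrite in_set /essential0 in_set essential_negf ffunE negbK. Qed.

Lemma card_essential g :
  #|essential R g| = (#|essential0 g| + #|essential0 (negf g)|)%N.
Proof.
rewrite essential0_negf -(cardsID [set x | ~~ g x] (essential R g)).
congr (_ + _)%N; apply: eq_card => x; rewrite !inE ?negbK //.
by rewrite andbC.
Qed.

Lemma card_essential0 g z : is_threshold R g -> g z -> (#|essential0 g| <= 2)%N.
Proof.
(* [E] collects the points with x + d in the grid; [colouring_pair_inj] leaves at most one. Outside
   [E], [g] is an open half-plane and [x] is the last point on its border. *)
move=> thg gz; pose E : {set point} :=
  [set x | [exists q, primitive (vec x q) && (g == colouring x (vec x q))]].
rewrite -(cardsID E) -[2%N]/(1 + 1)%N leq_add //.
  apply/card_le1_eqP=> x y; rewrite !inE => /andP[_ /existsP[q /andP[pq /eqP gq]]].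
  move=> /andP[_ /existsP[r /andP[pr /eqP gr]]].
  by have [] : x = y /\ q = r by apply: colouring_pair_inj => //; rewrite -gq.
have edge x : x \in essential0 g :\: E ->
    exists d, [/\ primitive d, g = colouring x d, exists q, vec q x = d &
    ~ (exists q, vec x q = d)].
  rewrite inE => /andP[xE]; rewrite inE => /andP[xess gx].
  have [z0 neq_z0] := other_point x.
  have [d [pd gd xd]] := essential_colouring neq_z0 thg xess gx.
  have nd : ~ (exists q, vec x q = d).
    move=> [q vq]; case/negP: xE; rewrite inE; apply/existsP; exists q.
    by rewrite vq pd gd eqxx.
  by exists d; split=> //; case: xd.
apply/card_le1_eqP=> x y /edge[d [pd gd [x' vx] xd]] /edge[e [pe ge [y' vy] ye]].
have gdE := last_on_line pd xd; have geE := last_on_line pe ye.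
have side : same_side x d y e by move=> p; rewrite -gdE -geE -gd -ge.
have eqde : d = e.
  by apply: (same_side_direction side vx vy pd pe (z := z)); rewrite -geE -ge.
rewrite -{}eqde {e} in pe ge ye geE side vy.
have := side y; have := side x; rewrite !cross_self_vec ltxx => sx sy.
(* Neither point is strictly left of the line through the other, so the lines coincide; both points
   being last on it, they are equal. *)
have c0 : cross d (vec x y) = 0.
  by have := cross_vecC d x y; lia.
have [t vt] := collinear_primitive pd c0; case: (ltgtP t 0) => t0.
- have vt' : vec y x = scale (- t) d.
    by move: vt; case: (d) => a b [e1 e2]; rewrite /vec /scale /=; congr pair; lia.
  have [|q vq] := point_between (t := 1) vt'; first by lia.
  by case: ye; exists q; rewrite vq /scale !mul1r; case: (d).
- have [|q vq] := point_between (t := 1) vt; first by lia.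
  by case: xd; exists q; rewrite vq /scale !mul1r; case: (d).
by apply/eqP; rewrite eq_sym -vec_eq0 vt t0 /scale !mul0r.
Qed.

(** An essential point of a constant is cut off alone by a line, but a point that is not a corner is
    the midpoint of two others. *)
Lemma essential_constant_corner x : x \in essential R [ffun=> false] ->
  ((x.1 : nat) == 0 \/ (x.1 : nat) == m.-1)%N /\
  ((x.2 : nat) == 0 \/ (x.2 : nat) == n.-1)%N.
Proof.
rewrite inE => /asboolP/threshold_represents[f fx].
have other q v : vec x q = v -> v != (0, 0) -> linform f.1.1 f.1.2 v < - affine f x.
  move=> vq; rewrite -vq vec_eq0 eq_sym => neq_q; have := fx q.
  by rewrite !ffunE (negbTE neq_q) -affineB /=; lra.
have Fx : 0 < affine f x by have := fx x; rewrite !ffunE eqxx.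
have opposite q q' v : vec x q = v -> vec x q' = (- v.1, - v.2) -> v != (0, 0) -> False.
  move=> vq vq' nz; have := other q v vq nz; have := other q' _ vq'.
  have -> : linform f.1.1 f.1.2 (- v.1, - v.2) = - linform f.1.1 f.1.2 v.
    by rewrite /linform /= !intrN; ring.
  move=> h1 h2; suff : (- v.1, - v.2) != (0, 0) by move/h1; lra.
  apply: contra nz => /eqP[e1 e2]; case: v {vq vq' h1 h2} e1 e2 => a b /= e1 e2.
  by apply/eqP; congr pair; lia.
have [l1 l2] := (ltn_ord x.1, ltn_ord x.2); split.
  apply/orP; apply: contraT; rewrite negb_or => /andP[x0 x1]; exfalso.
  have [||q [q1 q2]] := @point_at m n ((x.1 : nat)%:Z + 1) (x.2 : nat)%:Z; try lia.
  have [||q' [q1' q2']] := @point_at m n ((x.1 : nat)%:Z - 1) (x.2 : nat)%:Z; try lia.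
  apply: (@opposite q q' (1, 0)) => //; rewrite /vec ?q1 ?q2 ?q1' ?q2' /=; congr pair; lia.
apply/orP; apply: contraT; rewrite negb_or => /andP[x0 x1]; exfalso.
have [||q [q1 q2]] := @point_at m n (x.1 : nat)%:Z ((x.2 : nat)%:Z + 1); try lia.
have [||q' [q1' q2']] := @point_at m n (x.1 : nat)%:Z ((x.2 : nat)%:Z - 1); try lia.
apply: (@opposite q q' (0, 1)) => //; rewrite /vec ?q1 ?q2 ?q1' ?q2' /=; congr pair; lia.
Qed.

Lemma card_essential_constant : (#|essential R ([ffun=> false] : bfun)| <= 4)%N.
Proof.
have m0 : (0 < m)%N by lia.
have n0 : (0 < n)%N by lia.
have m1 : (m.-1 < m)%N by lia.
have n1 : (n.-1 < n)%N by lia.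
pose C : {set point} := setX [set Ordinal m0; Ordinal m1] [set Ordinal n0; Ordinal n1].
have : (#|C| <= 2 * 2)%N by rewrite cardsX leq_mul // cards2; case: (_ != _).
apply: leq_trans; apply: subset_leq_card; apply/subsetP=> x.
move=> /essential_constant_corner; case: x => i j /= [hi hj].
by rewrite !inE -!val_eqE /=; apply/andP; split; apply/orP.
Qed.

Lemma card_essential_le4 g : is_threshold R g -> (#|essential R g| <= 4)%N.
Proof.
move=> thg; have [/existsP[p gp]|] := boolP [exists p, g p]; last first.
  move=> /existsPn g0; suff -> : g = [ffun=> false] by apply: card_essential_constant.
  by apply/ffunP=> p; rewrite ffunE; apply: negbTE.
have [/existsP[q gq]|] := boolP [exists q, ~~ g q]; last first.
  move=> /existsPn g1; rewrite -essential_negf.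
  suff -> : negf g = [ffun=> false] by apply: card_essential_constant.
  by apply/ffunP=> q; rewrite !ffunE; apply: negbTE.
rewrite card_essential -[4%N]/(2 + 2)%N leq_add //; first exact: card_essential0 gp.
by apply: (@card_essential0 _ q); rewrite ?ffunE //; apply: negf_threshold.
Qed.

Lemma noncollinear_point p q : p != q -> exists r, cross (vec p q) (vec p r) != 0.
Proof.
rewrite -pair_eqE /= negb_and => /orP[] neq_pq.
  have [j neq_j] := neq_ord p.2 n_ge2; exists (p.1, j).
  rewrite /cross /= subrr mulr0 subr0 mulf_neq0 // subr_eq0.
    by apply: contra neq_pq; rewrite eqz_nat eq_sym.
  by rewrite eqz_nat.
have [j neq_j] := neq_ord p.1 m_ge2; exists (j, p.2).
rewrite /cross /= subrr mulr0 sub0r oppr_eq0 mulf_neq0 // subr_eq0.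
  by apply: contra neq_pq; rewrite eqz_nat eq_sym.
by rewrite eqz_nat.
Qed.

Lemma affz_threshold (f : int * int * int) :
  is_threshold R ([ffun p => 0 < affz f p] : bfun).
Proof.
apply: (@integer_lexicographic_threshold R m n f (0, 0, -1)) => p; rewrite ffunE.
by case: (ltgtP 0 (affz f p)) => h; [left|left|right].
Qed.

(* Barycentric coordinates interpolate arbitrary values at three noncollinear points. *)
Lemma threshold_interpolation p q r (a b c : bool) :
    cross (vec p q) (vec p r) != 0 ->
  exists h : bfun, [/\ is_threshold R h, h p = a, h q = b & h r = c].
Proof.
set D := cross _ _ => D_neq0.
pose s (t : bool) : int := if t then 1 else -1.
(* [l1] vanishes at [q] and [r] and equals [D] at [p], and cyclically; the extra factor [D] in [f]
   makes the signs independent of the orientation. *)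
pose l1 := crossf q (vec q r); pose l2 := crossf r (vec r p).
pose l3 := crossf p (vec p q).
pose f : int * int * int :=
  (D * (s a * l1.1.1 + s b * l2.1.1 + s c * l3.1.1),
   D * (s a * l1.1.2 + s b * l2.1.2 + s c * l3.1.2),
   D * (s a * l1.2 + s b * l2.2 + s c * l3.2)).
have fE z : affz f z = D * (s a * cross (vec q r) (vec q z) +
    s b * cross (vec r p) (vec r z) + s c * cross (vec p q) (vec p z)).
  by rewrite -!affz_crossf /affz /=; ring.
have sgn t u : t = u -> (0 < D * (s t * D)) = u.
  have : 0 < D * D by move: D_neq0; clear; nia.
  by move=> DD ->; case: u; rewrite /s /=; lia.
exists [ffun z => 0 < affz f z]; split; first exact: affz_threshold.
- rewrite ffunE fE -[RHS](@sgn a a) //; congr (0 < D * _).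
  by rewrite /D /cross /=; ring.
- rewrite ffunE fE -[RHS](@sgn b b) //; congr (0 < D * _).
  by rewrite /D /cross /=; ring.
rewrite ffunE fE -[RHS](@sgn c c) //; congr (0 < D * _).
by rewrite /D /cross /=; ring.
Qed.

Lemma subset_pair (A : {set point}) : (#|A| <= 2)%N ->
  exists p q, p != q /\ A \subset [set p; q].
Proof.
case: (ltngtP #|A| 1%N) => [|c2 le2|/eqP/cards1P[p ->]].
- rewrite ltnS leqn0 cards_eq0 => /eqP-> _.
  have m0 : (0 < m)%N by lia.
  have n0 : (0 < n)%N by lia.
  have [q neq_q] := other_point (Ordinal m0, Ordinal n0).
  by exists q, (Ordinal m0, Ordinal n0); rewrite sub0set.
- have /cards2P[p [q [neq_pq ->]]] : #|A| == 2%N by lia.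
  by exists p, q.
have [q neq_q] := other_point p.
by exists p, q; rewrite eq_sym neq_q sub1set !inE eqxx.
Qed.

Lemma card_essential_ge3 g : is_threshold R g -> (3 <= #|essential R g|)%N.
Proof.
move=> thg; rewrite ltnNge; apply/negP=> /subset_pair[p [q [neq_pq /subsetP sub]]].
have [r nc] := noncollinear_point neq_pq.
have [h [thh hp hq hr]] := @threshold_interpolation p q r (g p) (g q) (~~ g r) nc.
have neq_hg : h != g by apply/eqP=> e; move: hr; rewrite e; case: (g r).
have [x /sub] := essential_separates thg thh neq_hg.
by rewrite !inE => /orP[]/eqP->; rewrite ?hp ?hq eqxx.
Qed.

End EssentialBounds.

(** * Counting pairs by their difference *)

Section PairsByDifference.

Lemma sum_ltn_const (k c : nat) : (\sum_(a < k) (a < c) = minn k c)%N.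
Proof. by elim: k => [|k IHk]; rewrite ?big_ord0 ?big_ord_recr /= ?IHk; lia. Qed.

Lemma sum_diff_eq (k : nat) (a : 'I_k) (i : int) :
  (\sum_(b < k) ((b : nat)%:Z - (a : nat)%:Z == i)%R = (0 <= a%:Z + i < k%:Z)%R)%N.
Proof.
case: (boolP (0 <= a%:Z + i < k%:Z)) => in_k.
  have lt_k : (`|(a%:Z + i)%R| < k)%N by lia.
  rewrite (bigD1 (Ordinal lt_k)) //= big1 => [|b]; first by lia.
  by rewrite -val_eqE /=; lia.
by rewrite big1 // => b _; have := ltn_ord b; lia.
Qed.

Lemma card_diff_eq (k : nat) (i : int) : - k%:Z < i < k%:Z ->
  (#|[set z : 'I_k * 'I_k | (z.2 : nat)%:Z - (z.1 : nat)%:Z == i]| : nat)%:Z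
  = k%:Z - `|i|.
Proof.
move=> i_in; rewrite -sum1dep_card big_mkcond /=.
rewrite (eq_bigr (fun z : 'I_k * 'I_k =>
  ((z.2 : nat)%:Z - (z.1 : nat)%:Z == i) : nat)) => [|z _]; last by case: eqP.
rewrite -(pair_bigA _ (fun a b : 'I_k => ((b : nat)%:Z - (a : nat)%:Z == i) : nat)) /=.
under eq_bigr => a _ do rewrite sum_diff_eq.
have [i_ge0|i_lt0] := lerP 0 i.
  rewrite (eq_bigr (fun a : 'I_k => ((a : nat) < k - `|i|)%N : nat)) => [|a _].
    by rewrite sum_ltn_const; lia.
  by congr nat_of_bool; lia.
rewrite (eq_bigr (fun a : 'I_k => (1 - ((a : nat) < `|i|)%N)%N)) => [|a _].
  rewrite sumnB => [|a _]; last by case: (_ < _)%N.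
  by rewrite sum_ltn_const sum1_card card_ord; lia.
have := ltn_ord a; lia.
Qed.

(** This is the source of the weights in [f_gcd], applied to each coordinate in turn. *)
Lemma sum_over_differences (k : nat) (F : int -> int) :
  \sum_(z : 'I_k * 'I_k) F ((z.2 : nat)%:Z - (z.1 : nat)%:Z)
  = \sum_(i <- open_range k) (k%:Z - `|i|) * F i.
Proof.
pose D (z : 'I_k * 'I_k) : int := (z.2 : nat)%:Z - (z.1 : nat)%:Z.
transitivity (\sum_(z : 'I_k * 'I_k) \sum_(i <- open_range k | i == D z) F i).
  apply: eq_bigr => z _; rewrite -big_filter filter_pred1_uniq ?big_seq1 ?open_range_uniq //.
  case: z => a b; rewrite mem_open_range /D /=.
  by have := ltn_ord a; have := ltn_ord b; lia.
rewrite (exchange_big_dep xpredT) //= [LHS]big_seq_cond [RHS]big_seq_cond.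
apply: eq_bigr => i; rewrite andbT mem_open_range => i_in.
rewrite -(card_diff_eq i_in) -natz mulr_natl -sumr_const.
by apply: eq_bigl => z; rewrite inE eq_sym.
Qed.

End PairsByDifference.

(** * Double counting of threshold functions and essential points *)

Section Counting.
Variables (R : realType) (m n : nat).
Hypotheses (m_ge2 : (2 <= m)%N) (n_ge2 : (2 <= n)%N).
Notation point := ('I_m * 'I_n)%type.
Notation bfun := {ffun point -> bool}.
Implicit Types (g h : bfun) (p q r x y : point) (d e : int * int).

Definition gcd_pairs (k : nat) : {set point * point} :=
  [set z | gcdz (vec z.1 z.2).1 (vec z.1 z.2).2 == k%:Z].

Lemma f_gcd_card k : f_gcd k m n = (#|gcd_pairs k| : nat)%:Z.
Proof.
pose G (i : int) := \sum_(z : 'I_n * 'I_n)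
  ((gcdz i ((z.2 : nat)%:Z - (z.1 : nat)%:Z) == k%:Z : nat)%:Z : int).
transitivity (\sum_(i <- open_range m) (m%:Z - `|i|) * G i).
  apply: eq_bigr => i _; rewrite /G.
  rewrite (sum_over_differences _ (fun j => (gcdz i j == k%:Z : nat)%:Z)).
  rewrite big_distrr big_mkcond /=; apply: eq_bigr => j _.
  by case: (_ == _); rewrite ?mulr1 ?mulr0.
rewrite -(sum_over_differences _ G) /G pair_bigA /=.
pose u (w : point * point) := ((w.1.1, w.2.1), (w.1.2, w.2.2)).
pose u' (w : ('I_m * 'I_m) * ('I_n * 'I_n)) := ((w.1.1, w.2.1), (w.1.2, w.2.2)).
rewrite (reindex u) /=; last by exists u' => -[[a b] [c e]].
rewrite -sum1dep_card (big_morph Posz PoszD (erefl : Posz 0 = 0%R)) [RHS]big_mkcond.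
by apply: eq_bigr => w _ /=; case: (_ == _).
Qed.

Lemma constant_threshold (b : bool) : is_threshold R ([ffun=> b] : bfun).
Proof.
suff -> : [ffun=> b] = [ffun p => 0 < affz (0, 0, if b then 1 else -1) p] :> bfun.
  exact: affz_threshold.
by apply/ffunP=> p; rewrite !ffunE /affz /= !mul0r; case: b.
Qed.

Lemma card_thresholds : #|thresholds R m n| = (#|gcd_pairs 1| + 2)%N.
Proof.
pose col (z : point * point) := colouring z.1 (vec z.1 z.2).
have -> : thresholds R m n =
    [ffun=> false] |: ([ffun=> true] |: col @: gcd_pairs 1).
  apply/setP=> g; rewrite !inE; apply/asboolP/or3P => [thg|]; last first.
    case=> [/eqP->|/eqP->|/imsetP[z _ ->]]; try exact: constant_threshold.
    exact: colouring_threshold.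
  have [/existsP[q gq]|] := boolP [exists q, g q]; last first.
    move=> /existsPn g0; apply: Or31; apply/eqP/ffunP=> p.
    by rewrite ffunE; apply: negbTE.
  have [/existsP[p gp]|] := boolP [exists p, ~~ g p]; last first.
    move=> /existsPn g1; apply: Or32; apply/eqP/ffunP=> p.
    by have := g1 p; rewrite ffunE negbK.
  have [A [B [pAB gAB]]] := nonconstant_colouring thg gp gq.
  by apply: Or33; apply/imsetP; exists (A, B); rewrite // inE.
have m0 : (0 < m)%N by lia.
have n0 : (0 < n)%N by lia.
pose o : point := (Ordinal m0, Ordinal n0).
rewrite !cardsU1 card_in_imset => [|[A B] [A' B']]; last first.
  by rewrite !inE => p1 p2 /(colouring_pair_inj p1 p2)[/= -> ->].
have -> : [ffun=> true] \notin col @: gcd_pairs 1.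
  apply/imsetP=> -[[A B] _ /ffunP/(_ A)].
  by rewrite ffunE /col colouring_base.
have -> : [ffun=> false] \notin ([ffun=> true] |: col @: gcd_pairs 1).
  rewrite !inE negb_or; apply/andP; split.
    by apply/eqP=> /ffunP/(_ o); rewrite !ffunE.
  apply/imsetP=> -[[A B]]; rewrite inE => pAB /ffunP/(_ B).
  by rewrite ffunE /col /= colouring_tip.
by rewrite addnA addnC.
Qed.

Definition extendable (z : point * point) : bool :=
  [exists r, vec z.2 r == vec z.1 z.2].

(** The pair [(P, A)] goes to [(P, Q)] with [A] the midpoint of [P] and [Q]; the step is doubled, so
    its gcd becomes 2. *)
Lemma card_extendable : #|[set z in gcd_pairs 1 | extendable z]| = #|gcd_pairs 2|.
Proof.
(* The default [z.2] occurs only when [z] is not extendable. *)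
pose ext (z : point * point) :=
  (z.1, odflt z.2 [pick r | vec z.2 r == vec z.1 z.2]).
have extP z : extendable z -> vec z.2 (ext z).2 = vec z.1 z.2.
  rewrite /ext /=; case: pickP => [r /eqP //|no /existsP[r]].
  by rewrite no.
have <- : ext @: [set z in gcd_pairs 1 | extendable z] = gcd_pairs 2.
  apply/setP=> -[P Q]; apply/imsetP/idP => [[z]|].
    rewrite !inE => /andP[pz /extP ez] [-> ->].
    have -> : vec z.1 (ext z).2 = scale 2 (vec z.1 z.2).
      by move: ez => [e1 e2]; rewrite /vec /scale /=; congr pair; lia.
    by rewrite -mulz_gcdr (eqP pz).
  rewrite inE => /eqP gPQ; have /dvdzP[a ea] := dvdz_gcdl (vec P Q).1 (vec P Q).2.
  have /dvdzP[b eb] := dvdz_gcdr (vec P Q).1 (vec P Q).2.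
  have vPQ : vec P Q = scale 2 (a, b).
    rewrite gPQ in ea eb; rewrite /scale /= [2 * a]mulrC [2 * b]mulrC -ea -eb.
    by case: (vec P Q).
  have [//|A vA] := point_between (t := 1) vPQ.
  have vAQ : vec A Q = vec P A.
    by move: vPQ vA => [e1 e2] [e3 e4]; rewrite /vec; congr pair; lia.
  have exA : extendable (P, A) by apply/existsP; exists Q; rewrite /= vAQ.
  exists (P, A); last first.
    by congr pair; apply: (@vec_inj _ _ A); rewrite (extP _ exA).
  rewrite !inE exA andbT vA /scale /= !mul1r.
  by move: gPQ; rewrite vPQ /scale -mulz_gcdr /= => /eqP; lia.
rewrite card_in_imset // => -[P A] [P' A']; rewrite !inE.
move=> /andP[_ /extP] + /andP[_ /extP] + [eP eQ].
rewrite /ext /= {}eQ -{}eP; move: (odflt _ _) => Q [e1 e2] [e3 e4].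
by congr pair; apply: eq_point; lia.
Qed.

Lemma sum_essential0 :
  (\sum_(g in thresholds R m n) #|essential0 R g| + #|gcd_pairs 2| = 2 * #|gcd_pairs 1|)%N.
Proof.
(* The flag true selects the base [A] of an edge [(A, B)], with [B] one step ahead; false selects
   [B], with [A] one step behind, and only if no grid point is one step ahead, so that nothing is
   counted twice. *)
pose S : {set bool * (point * point)} :=
  [set w | (w.2 \in gcd_pairs 1) && (w.1 || ~~ extendable w.2)].
pose base (w : bool * (point * point)) := if w.1 then w.2.1 else w.2.2.
pose phi w := (colouring (base w) (vec w.2.1 w.2.2), base w).
have near w : w \in S -> (exists q, vec (base w) q = vec w.2.1 w.2.2) \/
    (exists q, vec q (base w) = vec w.2.1 w.2.2).
  by case: w => -[] [A B] _; [left; exists B|right; exists A].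
have tipP w : w \in S -> (exists q, vec (base w) q = vec w.2.1 w.2.2) <-> w.1.
  case: w => -[] [A B]; rewrite inE /= => wS; split=> //.
    by exists B.
  move=> [q vq]; case/andP: wS => _ /negP[]; apply/existsP; exists q.
  by rewrite /= vq.
have phi_inj : {in S &, injective phi}.
  move=> w w' wS wS' [ecol ebase].
  have pw : primitive (vec w.2.1 w.2.2) by move: wS; rewrite !inE => /andP[].
  have pw' : primitive (vec w'.2.1 w'.2.2) by move: wS'; rewrite !inE => /andP[].
  have ed : vec w.2.1 w.2.2 = vec w'.2.1 w'.2.2.
    apply: (colouring_direction_inj pw pw' (near _ wS)).
      by rewrite ebase; apply: near.
    by rewrite ecol ebase.
  have t := tipP w wS; have t' := tipP w' wS'; rewrite ed ebase in t.
  have e1 : w.1 = w'.1 by apply/idP/idP=> h; [apply/t'/t|apply/t/t'].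
  move: ebase ed e1; rewrite /base; case: (w) (w') => b [A B] [b' [A' B']] /=.
  move=> + + eb; rewrite -{}eb; case: b => <- ed; congr (_, (_, _)).
    exact: vec_inj ed.
  exact: vec_injl ed.
have phiS : phi @: S =
    [set z : bfun * point | (z.1 \in thresholds R m n) && (z.2 \in essential0 R z.1)].
  apply/setP=> -[g x]; apply/imsetP/idP => [[w wS [-> ->]]|].
    have pw : primitive (vec w.2.1 w.2.2) by move: wS; rewrite !inE => /andP[].
    rewrite !in_set colouring_base andbT; apply/andP; split.
      by apply/asboolP/colouring_threshold.
    have := @colouring_essential R m n (base w) _ (primitive_neq0 pw).
    by rewrite inE.
  rewrite inE => /andP[]; rewrite inE => /asboolP thg; rewrite inE => /andP[xess gx].
  have [z0 neq_z0] := other_point m_ge2 x.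
  have [d [pd gd xd]] := essential_colouring neq_z0 thg xess gx.
  have [/existsP[q /eqP vq]|no] := boolP [exists q, vec x q == d].
    exists (true, (x, q)); last by rewrite /phi /base /= vq -gd.
    by rewrite inE orTb andbT inE -/(primitive (vec x q)) vq.
  case: xd => -[q vq]; first by case/existsP: no; exists q; rewrite vq.
  exists (false, (q, x)); last by rewrite /phi /base /= vq -gd.
  rewrite inE; apply/andP; split; first by rewrite inE -/(primitive (vec q x)) vq.
  by rewrite /extendable vq.
have -> : (\sum_(g in thresholds R m n) #|essential0 R g|)%N = #|S|.
  rewrite -(card_in_imset phi_inj) phiS -sum1dep_card.
  under eq_bigr => g _ do rewrite -sum1_card.
  by rewrite pair_big_dep.
have -> : #|S| = (#|gcd_pairs 1| + #|gcd_pairs 1 :\: [set z | extendable z]|)%N.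
  rewrite -(cardsID [set w | w.1] S); congr (_ + _)%N.
    rewrite -(card_imset (gcd_pairs 1) (f := pair true)) => [|? ? []//].
    apply: eq_card => -[b z]; rewrite !inE /=; apply/idP/imsetP.
      by move=> /andP[/andP[zS _]]; case: b => // _; exists z; rewrite ?inE.
    by move=> [z' + [-> ->]]; rewrite inE => ->.
  rewrite -[RHS](card_imset _ (f := pair false)) => [|? ? []//].
  apply: eq_card => -[b z]; rewrite !inE /=; apply/idP/imsetP.
    move=> /andP[nb /andP[zS]]; case: b nb => //= _ ne.
    by exists z; rewrite ?inE ?ne.
  by move=> [z' + [-> ->]]; rewrite !inE => /andP[-> ->].
rewrite -card_extendable mulSn mul1n -addnA; congr (_ + _)%N.
rewrite addnC -[RHS](cardsID [set z | extendable z]); congr (_ + _)%N.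
by apply: eq_card => z; rewrite !inE.
Qed.

(** Negation permutes the threshold functions and exchanges zeros with ones, so the total is twice
    that of the essential zeros. *)
Lemma sum_essential : (\sum_(g in thresholds R m n) #|essential R g|
  + 2 * #|gcd_pairs 2| = 4 * #|gcd_pairs 1|)%N.
Proof.
have neg : (\sum_(g in thresholds R m n) #|essential0 R (negf g)|
    = \sum_(g in thresholds R m n) #|essential0 R g|)%N.
  rewrite (reindex_inj (inv_inj (@negfK m n))) /=.
  apply: eq_big => g; last by rewrite negfK.
  by rewrite !inE; apply/asboolP/asboolP=> /negf_threshold //; rewrite negfK.
under eq_bigr => g _ do rewrite card_essential.
rewrite big_split /= neg; have := sum_essential0.
by move: (\sum_(g in _) _)%N #|_| #|_| => s a b; lia.
Qed.

Lemma t_teachE k :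
  t_teach R m n k = (\sum_(g in thresholds R m n) (#|essential R g| == k))%N.
Proof.
rewrite /t_teach -sum1dep_card big_mkcondr /=; apply: eq_bigr => g.
by rewrite inE => /asboolP thg; rewrite minimal_teaching_set_essential //; case: eqP.
Qed.

Lemma t_teach_sum : (t_teach R m n 3 + t_teach R m n 4 = #|gcd_pairs 1| + 2)%N.
Proof.
rewrite -card_thresholds !t_teachE -big_split -sum1_card /=; apply: eq_bigr => g.
rewrite inE => /asboolP thg.
have := card_essential_ge3 m_ge2 n_ge2 thg; have := card_essential_le4 m_ge2 n_ge2 thg.
by case: #|_| => [|[|[|[|[|]]]]].
Qed.

Lemma t_teach_weighted_sum : (3 * t_teach R m n 3 + 4 * t_teach R m n 4
  + 2 * #|gcd_pairs 2| = 4 * #|gcd_pairs 1|)%N.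
Proof.
rewrite -sum_essential !t_teachE !big_distrr -big_split /=; congr (_ + _)%N.
apply: eq_bigr => g; rewrite inE => /asboolP thg.
have := card_essential_ge3 m_ge2 n_ge2 thg; have := card_essential_le4 m_ge2 n_ge2 thg.
by case: #|_| => [|[|[|[|[|]]]]].
Qed.

End Counting.

Theorem theorem3 (R : realType) (m n : nat) (hm : (2 <= m)%N) (hn : (2 <= n)%N) :
  (t_teach R m n 3)%:Z = 2 * f_gcd 2 m n + 8 /\
  (t_teach R m n 4)%:Z = f_gcd 1 m n - 2 * f_gcd 2 m n - 6.
Proof.
(* The equations t_3 + t_4 = f_1 + 2 and 3 t_3 + 4 t_4 = 4 f_1 - 2 f_2 determine t_3 and t_4. *)
have := t_teach_sum R hm hn; have := t_teach_weighted_sum R hm hn.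
by rewrite !f_gcd_card; move: #|gcd_pairs _ _ 1| #|gcd_pairs _ _ 2| => a b; lia.
Qed.
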